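(* Let $p$ be an odd prime, $m,s$ positive integers, $R=\mathbb F_{p^m}+u\mathbb F_{p^m}$ with $u^2=0$, let $\sigma$ be a ring automorphism of $R$, and let $\alpha,\beta$ be nonzero elements of $\mathbb F_{p^m}$. Then $\langle u\rangle$ is the unique $\sigma$-self-dual $(\alpha+u\beta)$-constacyclic code of length $p^s$ over $R$.
   Context: For a unit $\lambda$ of $R$, a $\lambda$-constacyclic code of length $n$ is an $R$-submodule of $R^n$ stable under $(x_0,\dots,x_{n-1})\mapsto(\lambda x_{n-1},x_0,\dots,x_{n-2})$; it is identified with an ideal of $R[x]/\langle x^n-\lambda\rangle$ via $(c_0,\dots,c_{n-1})\mapsto c_0+c_1x+\cdots+c_{n-1}x^{n-1}$. Here $\langle u\rangle$ denotes the code $uR^{p^s}=\{u\mathbf c:\mathbf c\in R^{p^s}\}$, i.e. the ideal generated by $u$ in $R[x]/\langle x^{p^s}-(\alpha+u\beta)\rangle$. The $\sigma$-dual of $C\subseteq R^n$ is $C^{\perp_\sigma}=\{\mathbf x\in R^n:\sum_{i=0}^{n-1}c_i\sigma(x_i)=0\text{ for all }\mathbf c\in C\}$; $C$ is $\sigma$-self-dual if $C=C^{\perp_\sigma}$ as subsets of $R^n$. *)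

(* Defs.v *)
From HB Require Import structures.
From mathcomp Require Import all_boot all_algebra.
From mathcomp Require Import qpoly.

Set Implicit Arguments.
Unset Strict Implicit.
Unset Printing Implicit Defensive.

Import GRing.Theory.
Local Open Scope ring_scope.

(* F + uF with u^2 = 0, realised as F[X]/<X^2> with u the class of X; the     *)
(* scalar a of F is embedded as a%:A.                                         *)
Definition chain_ring (F : finFieldType) := {poly %/ ('X^2 : {poly F})}.

HB.instance Definition _ (F : finFieldType) :=
  GRing.ComUnitAlgebra.on (chain_ring F).
HB.instance Definition _ (F : finFieldType) := Finite.on (chain_ring F).

Definition chain_u (F : finFieldType) : chain_ring F := 'qX.

Lemma chain_uE (F : finFieldType) : chain_u F = 'X :> {poly F}.
Proof. by rewrite /chain_u qpolyXE ?size_polyXn ?monicXn. Qed.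

Lemma chain_u_sq (F : finFieldType) : chain_u F ^+ 2 = 0.
Proof.
apply: val_inj; rewrite [LHS]poly_of_qpolyX chain_uE [in LHS]mk_monic_Xn.
by rewrite [LHS]Pdiv.RingMonic.rmodpp ?monicXn.
Qed.

Lemma chain_ring_decomp (F : finFieldType) (x : chain_ring F) :
  exists! ab : F * F, x = ab.1%:A + chain_u F * ab.2%:A.
Proof.
have valE (a b : F) :
    polyn (a%:A + chain_u F * b%:A) = a%:P + b *: 'X :> {poly F}.
  by rewrite -scalerAr mulr1 poly_of_qpolyD !poly_of_qpolyZ chain_uE alg_polyC.
have sz : (size (polyn x) <= 2)%N.
  by apply: leq_trans (size_npoly x) _; rewrite mk_monic_Xn size_polyXn.
exists ((polyn x)`_0, (polyn x)`_1); split=> [|[a b] ->].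
  apply: val_inj; rewrite [RHS]valE; apply/polyP => -[|[|i]] /=;
    rewrite coefD coefC coefZ coefX /= ?mulr0 ?mulr1 ?addr0 ?add0r //.
  by rewrite nth_default // (leq_trans sz).
by rewrite valE !coefD !coefC !coefZ !coefX /= mulr0 mulr1 addr0 add0r.
Qed.

Section Codes.
Variables (R : finComUnitRingType) (n : nat).

(* (x_0, ..., x_(n-1)) |-> (lambda x_(n-1), x_0, ..., x_(n-2)); ord_pred is   *)
(* the cyclic predecessor, so ord_pred of index 0 is index n - 1.             *)
Definition constashift (lambda : R) (x : 'rV[R]_n) : 'rV[R]_n :=
  \row_(i < n) if val i == 0%N then lambda * x 0 (ord_pred i)
               else x 0 (ord_pred i).

Definition constacyclic_code (lambda : R) (C : {set 'rV[R]_n}) : Prop :=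
  [/\ lambda \is a GRing.unit, submod_closed C
    & forall x, x \in C -> constashift lambda x \in C].

Definition sigma_dual (sigma : R -> R) (C : {set 'rV[R]_n}) : {set 'rV[R]_n} :=
  [set x : 'rV[R]_n | [forall c in C, \sum_(i < n) c 0 i * sigma (x 0 i) == 0]].

Definition sigma_self_dual (sigma : R -> R) (C : {set 'rV[R]_n}) : Prop :=
  C = sigma_dual sigma C.

Definition scaled_code (a : R) : {set 'rV[R]_n} :=
  [set a *: c | c : 'rV[R]_n].

End Codes.

Arguments scaled_code {R} n a.

(* Main.v *)
(* Let n = p ^ s and choose a in F with a ^ n = alpha. In characteristic p,
   evaluating (X - a) ^ n = X ^ n - alpha at the constacyclic shift T gives
   T ^ n - alpha = u beta. So every vector is f(T) e_0 for some f in F[X]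
   (u is itself a polynomial in T), and constacyclic codes correspond to
   ideals of F[X] containing (X - a) ^ (2n). Such ideals form a chain, hence
   every constacyclic code is comparable with <u>. Taking sigma-duals reverses
   inclusions, so two comparable sigma-self-dual codes are equal. *)
Require Import Defs.
From HB Require Import structures.
From mathcomp Require Import all_boot all_algebra.
From mathcomp Require Import qpoly finfield.

Import GRing.Theory.
Local Open Scope ring_scope.

(** * The constacyclic shift as a matrix $T$ *)

Section ShiftMatrix.
Variables (R : finComUnitRingType) (n' : nat) (lambda : R).
Local Notation n := n'.+1.

Lemma constashift_is_linear : linear (constashift lambda : 'rV[R]_n -> 'rV[R]_n).
Proof.
move=> a x y; apply/rowP => i; rewrite !mxE.
by case: ifP => _ //; rewrite mulrDr mulrCA.
Qed.

HB.instance Definition _ := GRing.isLinear.Build R 'rV[R]_n 'rV[R]_n *:%R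
  (constashift lambda) constashift_is_linear.

Definition shift_mx : 'M[R]_n := lin1_mx (constashift lambda).

Lemma mul_shift_mx (x : 'rV[R]_n) : x *m shift_mx = constashift lambda x.
Proof. exact: mul_rV_lin1. Qed.

Lemma delta_mul_shift_mx (i : 'I_n) :
  delta_mx 0 i *m shift_mx =
    (if i.+1 == n then lambda else 1) *: delta_mx 0 (ordS i)
      :> 'rV[R]_n.
Proof.
rewrite mul_shift_mx; apply/rowP => j; rewrite !mxE /=.
rewrite -(inj_eq (@ordS_inj n)) ord_predK.
have [->|_] := j =P ordS i; last by rewrite !mulr0 if_same.
rewrite !mulr1 /=; have := ltn_ord i.
by rewrite leq_eqVlt; case: eqP => [-> _ | _ /= lt_i]; rewrite ?modnn ?modn_small.
Qed.

Lemma delta0_mul_shift_mxX (i : 'I_n) :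
  delta_mx 0 0 *m shift_mx ^+ i = delta_mx 0 i :> 'rV[R]_n.
Proof.
case: i => i; elim: i => [|i IHi] lt_i.
  by rewrite expr0 mulmx1; congr delta_mx; apply: val_inj.
rewrite exprSr mulmxA (IHi (ltnW lt_i)) delta_mul_shift_mx /= ltn_eqF //.
by rewrite scale1r; congr delta_mx; apply: val_inj; rewrite /= modn_small.
Qed.

(** The shift brings $e_0$ back, multiplied by [lambda], after [n] steps; since $e_i = e_0 T^i$ and
    powers of $T$ commute, the same holds for every $e_i$. *)
Lemma shift_mx_expn : shift_mx ^+ n = lambda%:M.
Proof.
have delta0E : delta_mx 0 0 *m shift_mx ^+ n = lambda *: delta_mx 0 0 :> 'rV[R]_n.
  rewrite exprSr mulmxA (delta0_mul_shift_mxX ord_max) delta_mul_shift_mx /=.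
  by rewrite eqxx; congr (_ *: delta_mx _ _); apply: val_inj; rewrite /= modnn.
apply/row_matrixP => i; rewrite 2!rowE -delta0_mul_shift_mxX -mulmxA.
rewrite [X in _ *m X](_ : _ = shift_mx ^+ n *m shift_mx ^+ i); last first.
  by rewrite -[LHS]exprD addnC [LHS]exprD.
rewrite mulmxA delta0E -scalemxAl delta0_mul_shift_mxX.
by rewrite mul_mx_scalar.
Qed.

End ShiftMatrix.

(** Divisors of $(X-a)^{2n}$ are powers of $X-a$ up to units, so the gcd of [f] and [P ^+ 2] is some
    $(X-a)^k$, with $k < n$ because [P] does not divide [f]. This gcd divides [P], and a multiple of
    the Bezout relation gives the claim. *)
Lemma XsubC_exp_Bezout (F : fieldType) (a : F) (n : nat) (f : {poly F}) :
  let P := ('X - a%:P) ^+ n in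
  ~~ (P %| f) -> exists g h, P = g * f + h * P ^+ 2.
Proof.
move=> P ndvd; have [[g h] /= Bez] := Bezoutp f (P ^+ 2).
have dvdP2 := dvdp_gcdr f (P ^+ 2); have := dvdP2.
rewrite -[X in _ %| X]exprM => /dvdp_exp_XsubCP[k _ gcdE].
have lt_kn : (k < n)%N.
  rewrite ltnNge; apply: contra ndvd => le_nk.
  apply: (dvdp_trans _ (dvdp_gcdl f (P ^+ 2))).
  by rewrite (eqp_dvdr _ gcdE) dvdp_exp2l.
have : gcdp f (P ^+ 2) %| P by rewrite (eqp_dvdl _ gcdE) dvdp_exp2l // ltnW.
rewrite -(eqp_dvdl _ Bez) => /dvdpP[w PE].
by exists (w * g), (w * h); rewrite {1}PE mulrDr !mulrA.
Qed.

(** * Comparison of constacyclic codes with $\langle u\rangle$ *)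

Section Comparability.
Variables (F : fieldType) (R : finComUnitRingType) (iota : {rmorphism F -> R}).
Variables (u : R) (n' : nat) (a alpha beta : F).
Local Notation n := n'.+1.
Hypothesis u_sq : u ^+ 2 = 0.
Hypothesis decomp : forall x : R, exists b c : F, x = iota b + u * iota c.
Hypothesis beta_neq0 : beta != 0.
Hypothesis XsubC_expE : ('X - a%:P) ^+ n = 'X^n - alpha%:P :> {poly F}.

Let lambda := iota alpha + u * iota beta.
Let P : {poly F} := 'X^n - alpha%:P.
Let phi (f : {poly F}) : 'M[R]_n :=
  horner_mx (shift_mx R n' lambda) (map_poly iota f).

Let phiD f g : phi (f + g) = phi f + phi g.
Proof. by rewrite /phi !rmorphD. Qed.
Let phiM f g : phi (f * g) = phi f *m phi g.
Proof. by rewrite /phi !rmorphM. Qed.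
Let phi0 : phi 0 = 0.
Proof. by rewrite /phi !rmorph0. Qed.
Let phiC b : phi b%:P = (iota b)%:M.
Proof. by rewrite /phi map_polyC horner_mx_C. Qed.
Let phiXn k : phi 'X^k = shift_mx R n' lambda ^+ k.
Proof. by rewrite /phi map_polyXn rmorphXn /= horner_mx_X. Qed.

Let phiP : phi P = (u * iota beta)%:M.
Proof.
rewrite /P phiD -polyCN phiC phiXn shift_mx_expn rmorphN -raddfD /=.
by rewrite /lambda addrAC subrr add0r.
Qed.

Let phi_surj (v : 'rV[R]_n) : exists f, v = delta_mx 0 0 *m phi f.
Proof.
have coordE (i : 'I_n) :
    exists f, v 0 i *: delta_mx 0 i = delta_mx 0 0 *m phi f :> 'rV[R]_n.
  have [b [c ->]] := decomp (v 0 i).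
  (* The entry is $b + uc$; as $P(T) = u\beta$, the factor $c/\beta$ turns $P$ into $uc$, and $X^i$
     moves $e_0$ to $e_i$. *)
  exists ((b%:P + (c / beta)%:P * P) * 'X^i).
  rewrite phiM phiD phiM !phiC phiP -scalar_mxM -raddfD /= phiXn.
  rewrite mul_scalar_mx -scalemxAr delta0_mul_shift_mxX mulrCA -rmorphM /=.
  by rewrite divfK.
have [f fE] := fin_all_exists coordE.
exists (\sum_i f i); rewrite [v in LHS]row_sum_delta (eq_bigr _ (fun i _ => fE i)).
by rewrite /phi !raddf_sum.
Qed.

(** If $x = e_0 f(T)$ in [C] lies outside $\langle u\rangle$, then $P$ does not divide $f$, so $P =
    gf + hP^2$. As $P(T)^2 = (u\beta)^2 = 0$, this yields $u\beta = g(T)f(T)$, and every $u c$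
    becomes the image of $x$ under a polynomial in $T$. *)
Lemma constacyclic_comparable (C : {set 'rV[R]_n}) :
    submod_closed C -> (forall x, x \in C -> constashift lambda x \in C) ->
  (C \subset scaled_code n u) \/ (scaled_code n u \subset C).
Proof.
case=> C0 Clin Cshift.
have Cphi x f : x \in C -> x *m phi f \in C.
  elim/poly_ind: f x => [|f c IHf] x Cx; first by rewrite phi0 mulmx0.
  rewrite phiD phiM phiC -['X]expr1 phiXn expr1 mulmxDr mul_mx_scalar addrC.
  by apply: Clin => //; rewrite mulmxA mul_shift_mx Cshift ?IHf.
have [CsubU | /subsetPn[x Cx xU]] := boolP (C \subset _); [by left | right].
have [f xE] := phi_surj x.
have ndvd : ~~ (('X - a%:P) ^+ n %| f).
  apply: contra xU => /dvdpP[g fE]; apply/imsetP.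
  exists (iota beta *: (delta_mx 0 0 *m phi g)) => //.
  by rewrite xE fE XsubC_expE phiM phiP mul_mx_scalar -scalemxAr scalerA.
have [g [h]] := XsubC_exp_Bezout _ _ _ _ ndvd; rewrite XsubC_expE -/P => PE.
have PC y : y *m phi (P ^+ 2) = 0.
  rewrite expr2 phiM phiP -scalar_mxM mulrACA -expr2 u_sq mul0r.
  by rewrite raddf0 mulmx0.
apply/subsetP => _ /imsetP[c _ ->]; have [k ->] := phi_surj c.
have -> : u *: (delta_mx 0 0 *m phi k) = x *m phi (g * (k * beta^-1%:P)).
  have Ebeta : u%:M = phi (P * beta^-1%:P) :> 'M[R]_n.
    by rewrite phiM phiC phiP -scalar_mxM -mulrA -rmorphM /= divff ?rmorph1 ?mulr1.
  rewrite -mul_mx_scalar Ebeta -mulmxA -phiM mulrCA {1}PE mulrDl phiD mulmxDr.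
  rewrite [h * _ * _]mulrAC [phi (h * _ * _)]phiM [X in _ + X]mulmxA PC addr0.
  by rewrite xE -mulmxA -phiM; congr (_ *m phi _); rewrite mulrAC mulrC mulrA.
exact: Cphi.
Qed.

End Comparability.

Lemma sigma_dualS (R : finComUnitRingType) (n : nat) (sigma : R -> R)
    (C D : {set 'rV[R]_n}) :
  C \subset D -> sigma_dual sigma D \subset sigma_dual sigma C.
Proof.
move=> /subsetP sCD; apply/subsetP => x; rewrite !inE => /forall_inP xD.
by apply/forall_inP => c /sCD; apply: xD.
Qed.

Lemma self_dual_comparable_eq (R : finComUnitRingType) (n : nat)
    (sigma : R -> R) (C D : {set 'rV[R]_n}) :
    sigma_self_dual sigma C -> sigma_self_dual sigma D ->
  C \subset D \/ D \subset C -> C = D.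
Proof.
move=> Cdual Ddual sCD; apply/eqP; rewrite eqEsubset.
case: sCD => sub; rewrite sub ?andbT //= Cdual Ddual;
  by apply: sigma_dualS.
Qed.

(** * Annihilator of $u$, and the code $\langle u\rangle$ *)

Section ChainRing.
Variable F : finFieldType.
Local Notation u := (chain_u F).

Lemma chain_u_mul_eq0 (x : chain_ring F) :
  u * x = 0 <-> exists y, x = u * y.
Proof.
split=> [ux0 | [y ->]]; last by rewrite mulrA -expr2 chain_u_sq mul0r.
have [[a b] /= [xE _]] := chain_ring_decomp x.
have [ab [_ ab_uniq]] := chain_ring_decomp (0 : chain_ring F).
(* With $x = a + ub$, the product $ux$ is $ua$, so $0 = 0 + ua$ is a decomposition of zero;
   uniqueness against $0 + u0$ forces $a = 0$. *)
have a0 : ab = (0, a).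
  apply: ab_uniq; rewrite /= scale0r add0r -[LHS]ux0 xE mulrDr.
  by rewrite [u * (u * _)]mulrA -expr2 chain_u_sq mul0r addr0.
have : ab = (0, 0) by apply: ab_uniq; rewrite /= scale0r add0r mulr0.
rewrite a0 => -[aE]; exists b%:A.
by rewrite xE aE scale0r add0r.
Qed.

Lemma chain_sq_eq0 (x : chain_ring F) : x ^+ 2 = 0 <-> u * x = 0.
Proof.
split=> [x2 | /chain_u_mul_eq0[y ->]]; last by rewrite exprMn chain_u_sq mul0r.
have [[a b] /= [xE _]] := chain_ring_decomp x.
have ux : u * x = a *: u.
  rewrite xE mulrDr [u * (u * _)]mulrA -expr2 chain_u_sq mul0r addr0.
  by rewrite -scalerAr mulr1.
(* Against $u$, the element $x$ acts as the scalar $a$; once $a^2 u = 0$, cancelling one nonzero $a$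
   gives $au = 0$. *)
have : u * x ^+ 2 = a ^+ 2 *: u by rewrite expr2 mulrA ux -scalerAl ux scalerA.
rewrite x2 mulr0 => /esym a2u; rewrite ux.
have [-> | a_neq0] := eqVneq a 0; first by rewrite scale0r.
by apply: (scalerI a_neq0); rewrite scaler0 scalerA.
Qed.

(* The annihilator of u is the set of square-zero elements, a description that
   does not mention u and is therefore preserved by sigma. *)
Lemma chain_u_mul_rmorph_eq0
    (sigma : {rmorphism chain_ring F -> chain_ring F}) (x : chain_ring F) :
  injective sigma -> u * sigma x = 0 <-> u * x = 0.
Proof.
move=> sigma_inj; split=> /chain_sq_eq0 x2; apply/chain_sq_eq0.
  by apply: sigma_inj; rewrite rmorphXn rmorph0.
by rewrite -rmorphXn x2 rmorph0.
Qed.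

Lemma chain_unit (a b : F) : a != 0 -> a%:A + u * b%:A \is a GRing.unit.
Proof.
(* The inverse comes from $(a - ub)(a + ub) = a^2$. *)
move=> a_neq0; apply/unitrP; exists (a ^- 2 *: (a%:A - u * b%:A)).
suff E : a ^- 2 *: (a%:A - u * b%:A) * (a%:A + u * b%:A) = 1.
  by split=> //; rewrite mulrC.
rewrite -scalerAl -subr_sqr exprMn chain_u_sq mul0r subr0.
by rewrite exprZn expr1n scalerA mulVf ?expf_neq0 // scale1r.
Qed.

(** Replaces an image by a linear equation, from which stability and duality can be checked
    coordinatewise. *)
Lemma mem_scaled_chain_u (n : nat) (x : 'rV[chain_ring F]_n) :
  x \in scaled_code n u <-> u *: x = 0.
Proof.
split=> [/imsetP[y _ ->] | ux0].
  by rewrite scalerA -expr2 chain_u_sq scale0r.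
have coordE i : exists y, x 0 i = u * y.
  by apply/chain_u_mul_eq0; move/rowP/(_ i): ux0; rewrite !mxE.
have [y yE] := fin_all_exists coordE.
by apply/imsetP; exists (\row_i y i) => //; apply/rowP => i; rewrite !mxE.
Qed.

Lemma scaled_chain_u_constacyclic (n : nat) (lambda : chain_ring F) :
  lambda \is a GRing.unit -> constacyclic_code lambda (scaled_code n u).
Proof.
move=> lambda_unit; split=> //.
  split=> [|a x y]; first by apply/mem_scaled_chain_u; rewrite scaler0.
  move=> /mem_scaled_chain_u ux /mem_scaled_chain_u uy; apply/mem_scaled_chain_u.
  by rewrite scalerDr scalerA mulrC -scalerA ux uy scaler0 addr0.
move=> x /mem_scaled_chain_u ux; apply/mem_scaled_chain_u/rowP => i.
have ux0 j : u * x 0 j = 0 by move/rowP/(_ j): ux; rewrite !mxE.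
by rewrite !mxE; case: ifP => _ //; rewrite mulrCA ux0 mulr0.
Qed.

Lemma scaled_chain_u_self_dual (n : nat)
    (sigma : {rmorphism chain_ring F -> chain_ring F}) :
  injective sigma -> sigma_self_dual sigma (scaled_code n u).
Proof.
move=> sigma_inj; apply/setP => x; apply/idP/idP; rewrite inE.
  move=> /mem_scaled_chain_u ux; apply/forall_inP => _ /imsetP[c _ ->].
  apply/eqP/big1 => i _; rewrite mxE mulrAC.
  have /(chain_u_mul_rmorph_eq0 sigma _ sigma_inj) -> : u * x 0 i = 0.
    by move/rowP/(_ i): ux; rewrite !mxE.
  by rewrite mul0r.
move=> /forall_inP xdual; apply/mem_scaled_chain_u/rowP => i; rewrite !mxE.
apply/(chain_u_mul_rmorph_eq0 sigma _ sigma_inj).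
(* Pairing with the codeword $u e_i$ isolates $u\,\sigma(x_i)$. *)
have /xdual/eqP : u *: delta_mx 0 i \in scaled_code n u.
  by apply/imsetP; exists (delta_mx 0 i).
rewrite (bigD1 i) //= big1 ?addr0 => [|j /negPf j_i]; rewrite !mxE ?eqxx ?mulr1 //.
by rewrite j_i andbF mulr0 mul0r.
Qed.

End ChainRing.

Lemma finField_expn_root (F : finFieldType) (p m s : nat) (x : F) :
  (0 < m)%N -> #|F| = (p ^ m)%N -> exists y, y ^+ (p ^ s) = x.
Proof.
(* The exponents multiply to $p^{ms} = |F|^s$, and $s$ applications of $x^{|F|} = x$ return $x$. *)
move=> m_gt0 cardF; exists (x ^+ (p ^ (m * s - s))).
rewrite -exprM -expnD subnK ?leq_pmull // expnM -cardF.
by elim: s => [|s IHs]; rewrite ?expr1 // expnSr exprM IHs expf_card.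
Qed.

Theorem theorem4p2 (p m s : nat) (F : finFieldType)
    (p_prime : prime p) (p_odd : odd p) (m_gt0 : (0 < m)%N) (s_gt0 : (0 < s)%N)
    (cardF : #|F| = (p ^ m)%N)
    (sigma : {rmorphism chain_ring F -> chain_ring F})
    (sigma_bij : bijective sigma)
    (alpha beta : F) (alpha_neq0 : alpha != 0) (beta_neq0 : beta != 0) :
  let lambda : chain_ring F := alpha%:A + chain_u F * beta%:A in
  let Cu := scaled_code (p ^ s) (chain_u F) in
  [/\ constacyclic_code lambda Cu,
      sigma_self_dual sigma Cu
    & forall C : {set 'rV[chain_ring F]_(p ^ s)},
        constacyclic_code lambda C -> sigma_self_dual sigma C -> C = Cu].
Proof.
move=> lambda Cu.
have CuSD := scaled_chain_u_self_dual F (p ^ s) sigma (bij_inj sigma_bij).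
split=> // [|C [_ Csub Cshift] CSD].
  exact/scaled_chain_u_constacyclic/chain_unit.
apply: (self_dual_comparable_eq _ _ sigma) => //.
have [a aE] := finField_expn_root F p m s alpha m_gt0 cardF.
have XE : ('X - a%:P) ^+ (p ^ s) = 'X^(p ^ s) - alpha%:P :> {poly F}.
  (* [F] has characteristic $p$, so raising to the power $p^s$ is additive on polynomials. *)
  have pcharP : [pchar {poly F}].-nat (p ^ s)%N.
    rewrite (eq_pnat _ (pchar_poly F)) pnatX pnatE //.
    by rewrite (card_finPcharP cardF).
  by rewrite exprDn_pchar // exprNn_pchar // -rmorphXn aE.
have : (0 < p ^ s)%N by rewrite expn_gt0 prime_gt0.
(* The comparison uses $e_0$, so the length must be put in successor form. *)
rewrite /Cu; move: C Csub Cshift XE {Cu CuSD CSD}.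
case: (p ^ s)%N => // n C Csub Cshift XE _.
apply: (constacyclic_comparable F (chain_ring F) (in_alg (chain_ring F))
  (chain_u F) n a alpha beta) => //; first exact: chain_u_sq.
by move=> x; have [[b c] [xE _]] := chain_ring_decomp x; exists b, c.
Qed.
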